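(* Let $p=(0,0)\in\mathbb{R}^2$. For each integer $n\ge 1$ let $X_n=\bigcup_{i=1}^{n}\{(x,y)\in\mathbb{R}^2 : (x-\tfrac{1}{i})^2+y^2=\tfrac{1}{i^2}\}$, and let $X=\bigcup_{n=1}^{\infty}X_n$ be the Hawaiian earring, with the subspace topology from $\mathbb{R}^2$. Let $R_n:X\to X_n$ be the retraction that fixes $X_n$ pointwise and collapses every circle of index $i>n$ to the point $p$. Give $\pi_1(X,p)$ and each $\pi_1(X_n,p)$ the quotient topology inherited from the based loop space with the compact-open topology, and let $\lim_{\leftarrow}\pi_1(X_n,p)$ be the inverse limit space under the homomorphisms $\pi_1(X_n,p)\to\pi_1(X_{n-1},p)$ ($n\ge 2$) induced by the retractions $X_n\to X_{n-1}$ collapsing the $n$-th circle to $p$. Then the canonical injection $$\phi:\pi_1(X,p)\hookrightarrow \lim_{\leftarrow}\pi_1(X_n,p),\qquad \phi([f])=([R_1\circ f],[R_2\circ f],\dots),$$ is not a topological embedding; that is, $\phi$ is not a homeomorphism from $\pi_1(X,p)$ onto its image $\phi(\pi_1(X,p))$ with the subspace topology.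
   Context: Topological fundamental group: for a topological space $Y$ and $p\in Y$, let $C_p(Y)=\{f:[0,1]\to Y : f \text{ is continuous and } f(0)=f(1)=p\}$ with the compact-open topology. The topological fundamental group $\pi_1(Y,p)$ is the usual fundamental group equipped with the quotient topology from the canonical surjection $q:C_p(Y)\to\pi_1(Y,p)$, whose fibres are the path components of $C_p(Y)$ (that is, the based homotopy classes of loops). Thus $A\subset\pi_1(Y,p)$ is closed if and only if $q^{-1}(A)$ is closed in $C_p(Y)$. Inverse limit space: given topological spaces $A_1,A_2,\dots$ and continuous surjections $f_n:A_{n+1}\to A_n$, the inverse limit space is $\lim_{\leftarrow}A_n=\{(a_1,a_2,\dots)\in A_1\times A_2\times\cdots : f_n(a_{n+1})=a_n \text{ for all } n\}$, with the subspace topology from the product topology on $A_1\times A_2\times\cdots$. The $i$-th circle is $\{(x,y)\in\mathbb{R}^2 : (x-\tfrac1i)^2+y^2=\tfrac1{i^2}\}$. All these circles contain $p=(0,0)$. Each $\pi_1(X_n,p)$ has the discrete topology. It is a known fact that $\phi$ is a continuous injective homomorphism; this is why it is called the canonical injection. *)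

(* Defs.v *)
From HB Require Import structures.
From mathcomp Require Import all_boot all_order all_algebra generic_quotient.
From mathcomp Require Import all_classical reals topology normedtype homotopy.
From mathcomp Require Import ring lra.

Set Implicit Arguments.
Unset Strict Implicit.
Unset Printing Implicit Defensive.

Import Order.TTheory GRing.Theory Num.Theory.
Import numFieldNormedType.Exports.

Local Open Scope classical_set_scope.
Local Open Scope ring_scope.
Local Open Scope quotient_scope.

Section set_type_topology.
Context {X Y : topologicalType}.

Lemma set_val_continuous (A : set X) : continuous (\val : A -> X).
Proof. exact: initial_continuous. Qed.

Lemma continuous_set_type (A : set X) (f : Y -> A) :
  continuous (\val \o f) -> continuous f.
Proof. exact: continuous_comp_initial. Qed.

End set_type_topology.

Section continuity_tools.
Context {R : realType} {X Y Z : topologicalType}.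

Lemma continuousT_comp (f : X -> Y) (g : Y -> Z) :
  continuous f -> continuous g -> continuous (fun x => g (f x)).
Proof. by move=> cf cg x; apply: continuous_comp; [exact: cf|exact: cg]. Qed.

Lemma continuousT_pair (f : X -> Y) (g : X -> Z) :
  continuous f -> continuous g -> continuous (fun x => (f x, g x)).
Proof.
move=> cf cg x; apply: (@cvg_pair _ _ _ (nbhs x) (nbhs (f x)) (nbhs (g x)));
  [exact: cf|exact: cg].
Qed.

Lemma continuous_paste (u : X -> R) (c : R) (f g : X -> Y) :
  continuous u -> continuous f -> continuous g ->
  (forall x, u x = c -> f x = g x) ->
  continuous (fun x => if u x <= c then f x else g x).
Proof.
move=> cu cf cg fg; apply/continuous_subspace_setT.
have <- : [set x | u x <= c] `|` [set x | c <= u x] = [set: X].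
  by apply/seteqP; split=> // x _; case: (leP (u x) c) => ux;
    [left|right; exact: ltW].
apply: withinU_continuous.
- apply: (@preimage_closed _ _ _ [set t : R | t <= c]) => [x _|];
    [exact: cu|exact: closed_le].
- apply: (@preimage_closed _ _ _ [set t : R | c <= t]) => [x _|];
    [exact: cu|exact: closed_ge].
- apply: (@subspace_eq_continuous _ _ _ f).
    by move=> x; rewrite inE /from_subspace /= => ->.
  exact: continuous_subspaceT.
- apply: (@subspace_eq_continuous _ _ _ g).
    move=> x; rewrite inE /from_subspace /= => cux; case: ifP => // uxc.
    by rewrite fg //; apply/eqP; rewrite eq_le uxc cux.
  exact: continuous_subspaceT.
Qed.

End continuity_tools.

Definition homeomorphism {X Y : topologicalType} (f : X -> Y) : Prop :=
  continuous f /\ exists g : Y -> X, [/\ cancel f g, cancel g f & continuous g].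

Definition corestriction {X Y : Type} (f : X -> Y) (x : X) : range f :=
  exist (fun y => y \in range f) (f x) (mem_set (imageT f x)).

Definition topological_embedding {X Y : topologicalType} (f : X -> Y) : Prop :=
  homeomorphism (corestriction f).

(** Sequences are indexed from 0, so that [A n] is the
    (n+1)-st space of the inverse system. *)

Definition inverse_limit (A : nat -> topologicalType)
    (f : forall n, A n.+1 -> A n) : set (prod_topology A) :=
  [set a | forall n, f n (a n.+1) = a n].

Definition unit_interval (R : realType) : Type := `[0 : R, 1]%classic.

HB.instance Definition _ (R : realType) :=
  Topological.copy (unit_interval R) `[0 : R, 1]%classic.

Section unit_interval.
Context {R : realType}.
Local Notation I := (unit_interval R).

Lemma unit_interval_subproof (t : R) : 0 <= t <= 1 -> t \in `[0 : R, 1]%classic.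
Proof. by move=> t01; rewrite inE /= in_itv. Qed.

Definition mk_unit (t : R) (t01 : 0 <= t <= 1) : I :=
  exist (fun t => t \in `[0 : R, 1]%classic) t (unit_interval_subproof t01).

Definition unit_val (t : I) : R := \val t.

Lemma unit_val_bound (t : I) : 0 <= unit_val t <= 1.
Proof. by have := valP t; rewrite inE /= in_itv. Qed.

Lemma unit_val_continuous : continuous unit_val.
Proof. exact: set_val_continuous. Qed.

Lemma unit_val_inj : injective unit_val.
Proof. exact: val_inj. Qed.

Let zero01 : 0 <= (0 : R) <= 1.
Proof. by rewrite lexx ler01. Qed.
Let one01 : 0 <= (1 : R) <= 1.
Proof. by rewrite lexx ler01. Qed.

Lemma mk_unit_neq : mk_unit zero01 != mk_unit one01.
Proof. by apply/eqP => -[] /eqP; rewrite eq_sym oner_eq0. Qed.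

HB.instance Definition _ := isBiPointed.Build I mk_unit_neq.

Lemma unit_val0 : unit_val zero = 0. Proof. by []. Qed.
Lemma unit_val1 : unit_val one = 1. Proof. by []. Qed.

Lemma unit_proj_subproof (t : R) : 0 <= Num.max 0 (Num.min 1 t) <= 1.
Proof. by rewrite le_max lexx ge_max ler01 ge_min lexx. Qed.

Definition unit_proj (t : R) : I := mk_unit (unit_proj_subproof t).

Lemma unit_proj_continuous : continuous unit_proj.
Proof.
apply: continuous_set_type => t.
apply: (@continuous_max R R (cst 0) (fun t => Num.min 1 t)).
  exact: cvg_cst.
apply: (@continuous_min R R (cst 1) id); [exact: cvg_cst|exact: cvg_id].
Qed.

Lemma unit_projE (t : R) : 0 <= t <= 1 -> unit_val (unit_proj t) = t.
Proof.
by case/andP => t0 t1; rewrite /unit_val /=; rewrite min_r // max_r.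
Qed.

Lemma unit_proj0 (t : R) : t = 0 -> unit_proj t = zero.
Proof.
by move=> ->; apply: unit_val_inj; rewrite unit_projE ?unit_val0 // lexx ler01.
Qed.

Lemma unit_proj1 (t : R) : t = 1 -> unit_proj t = one.
Proof.
by move=> ->; apply: unit_val_inj; rewrite unit_projE ?unit_val1 // lexx ler01.
Qed.

Lemma unit_valK (t : I) : unit_proj (unit_val t) = t.
Proof. by apply: unit_val_inj; rewrite unit_projE // unit_val_bound. Qed.

End unit_interval.

(** [pathType] carries the compact-open topology. *)

Notation loop_space R p := {path (unit_interval R) from p to p}.

Section loop_homotopy.
Context {R : realType} {Y : topologicalType} (p : Y).
Local Notation I := (unit_interval R).
Implicit Types (f g h : loop_space R p) (e : R -> R).

Definition loop_homotopic f g : Prop :=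
  exists H : I * I -> Y,
    [/\ continuous H,
        forall s, H (s, zero) = f s,
        forall s, H (s, one) = g s,
        forall t, H (zero, t) = p &
        forall t, H (one, t) = p].

Let fst_continuous : continuous (fun z : I * I => unit_val z.1).
Proof.
by apply: (continuousT_comp _ unit_val_continuous) => z; exact: cvg_fst.
Qed.

Let snd_continuous : continuous (fun z : I * I => unit_val z.2).
Proof.
by apply: (continuousT_comp _ unit_val_continuous) => z; exact: cvg_snd.
Qed.

Let affine_continuous {X : topologicalType} (u : X -> R) (a b : R) :
  continuous u -> continuous (fun x => unit_proj (a * u x + b)).
Proof.
move=> cu; apply: (continuousT_comp _ unit_proj_continuous) => x.
apply: cvgD; last exact: cvg_cst.
by apply: cvgM; [exact: cvg_cst|exact: cu].
Qed.

Lemma loop_homotopic_reparam (c : I -> Y) e1 e2 f g :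
  continuous c -> continuous e1 -> continuous e2 ->
  e1 0 = e2 0 -> e1 1 = e2 1 ->
  (forall s, f s = c (unit_proj (e1 (unit_val s)))) ->
  (forall s, g s = c (unit_proj (e2 (unit_val s)))) ->
  loop_homotopic f g.
Proof.
move=> cc ce1 ce2 e0 e1' fE gE.
exists (fun z => c (unit_proj ((1 - unit_val z.2) * e1 (unit_val z.1) +
                               unit_val z.2 * e2 (unit_val z.1)))); split=> /=.
- apply: (continuousT_comp _ cc).
  apply: (continuousT_comp _ unit_proj_continuous) => z.
  apply: cvgD; apply: cvgM.
  + by apply: cvgB; [exact: cvg_cst|exact: snd_continuous].
  + exact: (continuousT_comp fst_continuous ce1).
  + exact: snd_continuous.
  + exact: (continuousT_comp fst_continuous ce2).
- by move=> s; rewrite unit_val0 subr0 mul1r mul0r addr0 fE.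
- by move=> s; rewrite unit_val1 subrr mul0r mul1r add0r gE.
- move=> t; rewrite unit_val0 -e0 -mulrDl subrK mul1r.
  by rewrite -{1}(unit_val0 (R := R)) -fE path_zero.
- move=> t; rewrite unit_val1 -e1' -mulrDl subrK mul1r.
  by rewrite -{1}(unit_val1 (R := R)) -fE path_one.
Qed.

Lemma loop_homotopic_refl f : loop_homotopic f f.
Proof.
by apply: (@loop_homotopic_reparam f id id) => // [|t|t|s|s];
  [exact: cts_fun|exact: cvg_id|exact: cvg_id|rewrite unit_valK|
   rewrite unit_valK].
Qed.

Lemma loop_homotopic_sym f g : loop_homotopic f g -> loop_homotopic g f.
Proof.
case=> H [cH H0 H1 Hl Hr].
exists (fun z => H (z.1, unit_proj (-1 * unit_val z.2 + 1))); split=> /=.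
- apply: (continuousT_comp _ cH); apply: continuousT_pair.
    by move=> z; exact: cvg_fst.
  exact: affine_continuous.
- by move=> s; rewrite unit_proj1 // unit_val0 mulr0 add0r.
- by move=> s; rewrite unit_proj0 // unit_val1 mulr1 addNr.
- by move=> t; exact: Hl.
- by move=> t; exact: Hr.
Qed.

Lemma loop_homotopic_trans f g h :
  loop_homotopic f g -> loop_homotopic g h -> loop_homotopic f h.
Proof.
case=> F [cF F0 F1 Fl Fr] [G [cG G0 G1 Gl Gr]].
exists (fun z => if unit_val z.2 <= 2^-1
  then F (z.1, unit_proj (2 * unit_val z.2 + 0))
  else G (z.1, unit_proj (2 * unit_val z.2 + - 1))); split=> /=.
- apply: continuous_paste => //.
  + apply: (continuousT_comp _ cF); apply: continuousT_pair.
      by move=> z; exact: cvg_fst.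
    exact: affine_continuous.
  + apply: (continuousT_comp _ cG); apply: continuousT_pair.
      by move=> z; exact: cvg_fst.
    exact: affine_continuous.
  + move=> z zE; rewrite unit_proj1 ?F1; last by rewrite zE; field.
    by rewrite unit_proj0 ?G0 //; rewrite zE; field.
- move=> s; rewrite unit_val0 invr_ge0 ler0n unit_proj0 //.
  by rewrite mulr0 add0r.
- move=> s; rewrite unit_val1; case: ifP => [?|_]; first by exfalso; lra.
  by rewrite unit_proj1 //; ring.
- by move=> t; rewrite Fl Gl if_same.
- by move=> t; rewrite Fr Gr if_same.
Qed.

Section concatenation.
Variables f g : loop_space R p.

Definition loop_cat_fun (s : I) : Y :=
  if unit_val s <= 2^-1 then f (unit_proj (2 * unit_val s))
  else g (unit_proj (2 * unit_val s - 1)).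

Lemma loop_cat_continuous : continuous loop_cat_fun.
Proof.
apply: continuous_paste; first exact: unit_val_continuous.
- apply: (continuousT_comp _ (@cts_fun _ _ f)).
  have := affine_continuous (a := 2) (b := 0) unit_val_continuous.
  by under eq_fun do rewrite addr0.
- apply: (continuousT_comp _ (@cts_fun _ _ g)).
  exact: affine_continuous unit_val_continuous.
- move=> s sE; rewrite unit_proj1 ?path_one; last by rewrite sE; field.
  by rewrite unit_proj0 ?path_zero //; rewrite sE; field.
Qed.

Lemma loop_cat_zero : loop_cat_fun zero = p.
Proof.
by rewrite /loop_cat_fun unit_val0 invr_ge0 ler0n mulr0 unit_proj0 ?path_zero.
Qed.

Lemma loop_cat_one : loop_cat_fun one = p.
Proof.
rewrite /loop_cat_fun unit_val1; case: ifP => [?|_]; first by exfalso; lra.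
by rewrite unit_proj1 ?path_one //; ring.
Qed.

Definition loop_cat : loop_space R p :=
  mk_path loop_cat_continuous loop_cat_zero loop_cat_one.

Lemma loop_catE (s : I) :
  loop_cat s = if unit_val s <= 2^-1 then f (unit_proj (2 * unit_val s))
               else g (unit_proj (2 * unit_val s - 1)).
Proof. by []. Qed.

End concatenation.

Section reversal.
Variable f : loop_space R p.

Definition loop_rev_fun (s : I) : Y := f (unit_proj (1 - unit_val s)).

Lemma loop_rev_continuous : continuous loop_rev_fun.
Proof.
apply: (continuousT_comp _ (@cts_fun _ _ f)).
have := affine_continuous (a := -1) (b := 1) unit_val_continuous.
by under eq_fun do rewrite mulN1r addrC.
Qed.

Lemma loop_rev_zero : loop_rev_fun zero = p.
Proof. by rewrite /loop_rev_fun unit_val0 subr0 unit_proj1 ?path_one. Qed.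

Lemma loop_rev_one : loop_rev_fun one = p.
Proof. by rewrite /loop_rev_fun unit_val1 subrr unit_proj0 ?path_zero. Qed.

Definition loop_rev : loop_space R p :=
  mk_path loop_rev_continuous loop_rev_zero loop_rev_one.

Lemma loop_revE (s : I) : loop_rev s = f (unit_proj (1 - unit_val s)).
Proof. by []. Qed.

End reversal.

Definition loop_const : loop_space R p := cst p.

Lemma loop_cat_homotopic f f' g g' :
  loop_homotopic f f' -> loop_homotopic g g' ->
  loop_homotopic (loop_cat f g) (loop_cat f' g').
Proof.
case=> F [cF F0 F1 Fl Fr] [G [cG G0 G1 Gl Gr]].
exists (fun z => if unit_val z.1 <= 2^-1
  then F (unit_proj (2 * unit_val z.1 + 0), z.2)
  else G (unit_proj (2 * unit_val z.1 + - 1), z.2)); split=> /=.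
- apply: continuous_paste => //.
  + apply: (continuousT_comp _ cF); apply: continuousT_pair.
      exact: affine_continuous.
    by move=> z; exact: cvg_snd.
  + apply: (continuousT_comp _ cG); apply: continuousT_pair.
      exact: affine_continuous.
    by move=> z; exact: cvg_snd.
  + move=> z zE; rewrite unit_proj1 ?Fr; last by rewrite zE; field.
    by rewrite unit_proj0 ?Gl //; rewrite zE; field.
- by move=> s; rewrite loop_catE F0 G0 addr0.
- by move=> s; rewrite loop_catE F1 G1 addr0.
- by move=> t; rewrite unit_val0 invr_ge0 ler0n unit_proj0 ?Fl // mulr0 addr0.
- move=> t; rewrite unit_val1; case: ifP => [?|_]; first by exfalso; lra.
  by rewrite unit_proj1 ?Gr //; ring.
Qed.

Lemma loop_rev_homotopic f f' :
  loop_homotopic f f' -> loop_homotopic (loop_rev f) (loop_rev f').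
Proof.
case=> F [cF F0 F1 Fl Fr].
exists (fun z => F (unit_proj (-1 * unit_val z.1 + 1), z.2)); split=> /=.
- apply: (continuousT_comp _ cF); apply: continuousT_pair.
    exact: affine_continuous.
  by move=> z; exact: cvg_snd.
- by move=> s; rewrite loop_revE F0 mulN1r addrC.
- by move=> s; rewrite loop_revE F1 mulN1r addrC.
- by move=> t; rewrite unit_val0 mulr0 add0r unit_proj1.
- by move=> t; rewrite unit_val1 mulr1 addNr unit_proj0.
Qed.

Let affineR_continuous (a b : R) : continuous (fun s : R => a * s + b).
Proof.
move=> s; apply: cvgD; last exact: cvg_cst.
by apply: cvgM; [exact: cvg_cst|exact: cvg_id].
Qed.

Let min_continuous e1 e2 : continuous e1 -> continuous e2 ->
  continuous (fun s => Num.min (e1 s) (e2 s)).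
Proof.
by move=> c1 c2 s; apply: (@continuous_min R R e1 e2); [exact: c1|exact: c2].
Qed.

Let max_continuous e1 e2 : continuous e1 -> continuous e2 ->
  continuous (fun s => Num.max (e1 s) (e2 s)).
Proof.
by move=> c1 c2 s; apply: (@continuous_max R R e1 e2); [exact: c1|exact: c2].
Qed.

Local Ltac unit_side := lazymatch goal with
  | |- is_true (_ && _) => apply/andP; split; lra
  | |- is_true _ => lra
  | |- _ = false => apply/negbTE; rewrite -ltNge; lra
  | |- _ => idtac
  end.

Lemma loop_catA f g h : loop_homotopic (loop_cat f (loop_cat g h))
                                       (loop_cat (loop_cat f g) h).
Proof.
pose e (s : R) :=
  Num.min (2 * s + 0) (Num.min (1 * s + 4^-1) (2^-1 * s + 2^-1)).
apply: (@loop_homotopic_reparam (loop_cat f (loop_cat g h)) id e).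
- exact: cts_fun.
- by move=> s; exact: cvg_id.
- by do 2 (apply: min_continuous; first exact: affineR_continuous);
    exact: affineR_continuous.
- by rewrite /e (@min_l _ _ (1 * 0 + 4^-1)) ?min_l; lra.
- by rewrite /e (@min_r _ _ (1 * 1 + 4^-1)) ?min_r; lra.
- by move=> s; rewrite unit_valK.
- move=> s; have /andP[] := unit_val_bound s; set x := unit_val s => x0 x1.
  have [xq|xq] := leP x 4^-1.
    have -> : e x = 2 * x by rewrite /e addr0 min_l // le_min; apply/andP; split; lra.
    by rewrite !loop_catE -/x (@unit_projE R (2 * x)) ?ifT; unit_side.
  have [xh|xh] := leP x 2^-1.
    have -> : e x = x + 4^-1 by rewrite /e mul1r (@min_l _ _ (x + _)) ?min_r; lra.
    rewrite loop_catE -/x ifT // loop_catE unit_projE ?ifF; unit_side.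
    rewrite loop_catE unit_projE ?ifF; unit_side.
    rewrite loop_catE unit_projE ?ifT; unit_side.
    by congr (g (unit_proj _)); field.
  have -> : e x = 2^-1 * x + 2^-1.
    by rewrite /e mul1r (@min_r _ _ (x + _)) ?min_r; lra.
  rewrite loop_catE -/x ifF; unit_side.
  rewrite loop_catE unit_projE ?ifF; unit_side.
  rewrite loop_catE unit_projE ?ifF; unit_side.
  by congr (h (unit_proj _)); field.
Qed.

Lemma loop_cat1l f : loop_homotopic (loop_cat loop_const f) f.
Proof.
apply: (@loop_homotopic_reparam f
  (fun s => Num.max (2 * s + - 1) (0 * s + 0)) id).
- exact: cts_fun.
- by apply: max_continuous; exact: affineR_continuous.
- by move=> s; exact: cvg_id.
- by case: leP; lra.
- by case: leP; lra.
- move=> s; rewrite loop_catE; have [xh|xh] := leP (unit_val s) 2^-1.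
    by rewrite (@max_r _ R) ?(@unit_proj0 R (0 * _ + 0)) ?path_zero //; lra.
  by rewrite (@max_l _ R) //; lra.
- by move=> s; rewrite unit_valK.
Qed.

Lemma loop_cat1r f : loop_homotopic (loop_cat f loop_const) f.
Proof.
apply: (@loop_homotopic_reparam f
  (fun s => Num.min (2 * s + 0) (0 * s + 1)) id).
- exact: cts_fun.
- by apply: min_continuous; exact: affineR_continuous.
- by move=> s; exact: cvg_id.
- by case: leP; lra.
- by case: leP; lra.
- move=> s; rewrite loop_catE; have [xh|xh] := leP (unit_val s) 2^-1.
    by rewrite (@min_l _ R) ?addr0 //; lra.
  by rewrite (@min_r _ R) ?(@unit_proj1 R (0 * _ + 1)) ?path_one //; lra.
- by move=> s; rewrite unit_valK.
Qed.

Lemma loop_catVl f : loop_homotopic (loop_cat (loop_rev f) f) loop_const.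
Proof.
apply: (@loop_homotopic_reparam f
  (fun s => Num.max (2 * s + - 1) (- 2 * s + 1)) (fun=> 1)).
- exact: cts_fun.
- by apply: max_continuous; exact: affineR_continuous.
- by move=> s; exact: cvg_cst.
- by case: leP; lra.
- by case: leP; lra.
- move=> s; have /andP[x0 x1] := unit_val_bound s.
  rewrite loop_catE; have [xh|xh] := leP (unit_val s) 2^-1.
    rewrite (@max_r _ R) ?loop_revE ?(@unit_projE R (2 * _)); unit_side.
    by congr (f (unit_proj _)); ring.
  by rewrite (@max_l _ R) //; lra.
- by move=> s; rewrite unit_proj1 // path_one.
Qed.

Lemma loop_catVr f : loop_homotopic (loop_cat f (loop_rev f)) loop_const.
Proof.
apply: (@loop_homotopic_reparam f
  (fun s => Num.min (2 * s + 0) (- 2 * s + 2)) (fun=> 0)).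
- exact: cts_fun.
- by apply: min_continuous; exact: affineR_continuous.
- by move=> s; exact: cvg_cst.
- by case: leP; lra.
- by case: leP; lra.
- move=> s; have /andP[x0 x1] := unit_val_bound s.
  rewrite loop_catE; have [xh|xh] := leP (unit_val s) 2^-1.
    by rewrite (@min_l _ R) ?addr0 //; lra.
  rewrite (@min_r _ R) ?loop_revE ?(@unit_projE R (2 * _ - 1)); unit_side.
  by congr (f (unit_proj _)); ring.
- by move=> s; rewrite unit_proj0 // path_zero.
Qed.

End loop_homotopy.

Section fundamental_group.
Context {R : realType} {Y : topologicalType} (p : Y).

Let hrel (f g : loop_space R p) : bool := `[< loop_homotopic f g >].

Let hrel_refl : reflexive hrel.
Proof. by move=> f; apply/asboolP; exact: loop_homotopic_refl. Qed.

Let hrel_sym : symmetric hrel.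
Proof.
by move=> f g; apply/asboolP/asboolP; exact: loop_homotopic_sym.
Qed.

Let hrel_trans : transitive hrel.
Proof.
move=> g f h /asboolP fg /asboolP gh; apply/asboolP.
exact: loop_homotopic_trans fg gh.
Qed.

Definition loop_homotopy_rel := EquivRel hrel hrel_refl hrel_sym hrel_trans.

Definition pi1 : Type := quotient_topology {eq_quot loop_homotopy_rel}.

HB.instance Definition _ :=
  Topological.copy pi1 (quotient_topology {eq_quot loop_homotopy_rel}).
HB.instance Definition _ :=
  Quotient.copy pi1 (quotient_topology {eq_quot loop_homotopy_rel}).

Definition loop_class (f : loop_space R p) : pi1 := \pi_pi1 f.

Lemma loop_classP (f g : loop_space R p) :
  loop_class f = loop_class g <-> loop_homotopic f g.
Proof.
split=> [/eqmodP /asboolP //|fg].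
by apply/eqmodP/asboolP.
Qed.

Lemma loop_class_repr (a : pi1) : loop_class (repr a) = a.
Proof. exact: reprK. Qed.

Lemma repr_loop_class (f : loop_space R p) :
  loop_homotopic (repr (loop_class f)) f.
Proof. by apply/loop_classP; exact: loop_class_repr. Qed.

Lemma open_pi1 (U : set pi1) : open U <-> open (loop_class @^-1` U).
Proof. by []. Qed.

Definition pi1_mul (a b : pi1) : pi1 := loop_class (loop_cat (repr a) (repr b)).
Definition pi1_one : pi1 := loop_class (loop_const p).
Definition pi1_inv (a : pi1) : pi1 := loop_class (loop_rev (repr a)).

Lemma pi1_mulE (f g : loop_space R p) :
  pi1_mul (loop_class f) (loop_class g) = loop_class (loop_cat f g).
Proof. by apply/loop_classP/loop_cat_homotopic; exact: repr_loop_class. Qed.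

Lemma pi1_invE (f : loop_space R p) :
  pi1_inv (loop_class f) = loop_class (loop_rev f).
Proof. by apply/loop_classP/loop_rev_homotopic; exact: repr_loop_class. Qed.

Let pi1_mulA : associative pi1_mul.
Proof.
move=> a b c; rewrite -(loop_class_repr a) -(loop_class_repr b).
rewrite -(loop_class_repr c) !pi1_mulE.
by apply/loop_classP; exact: loop_catA.
Qed.

Let pi1_mul1g : left_id pi1_one pi1_mul.
Proof.
move=> a; rewrite -(loop_class_repr a) pi1_mulE.
by apply/loop_classP; exact: loop_cat1l.
Qed.

Let pi1_mulg1 : right_id pi1_one pi1_mul.
Proof.
move=> a; rewrite -(loop_class_repr a) pi1_mulE.
by apply/loop_classP; exact: loop_cat1r.
Qed.

Let pi1_mulVg : left_inverse pi1_one pi1_inv pi1_mul.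
Proof.
move=> a; rewrite -(loop_class_repr a) pi1_invE pi1_mulE.
by apply/loop_classP; exact: loop_catVl.
Qed.

Let pi1_mulgV : right_inverse pi1_one pi1_inv pi1_mul.
Proof.
move=> a; rewrite -(loop_class_repr a) pi1_invE pi1_mulE.
by apply/loop_classP; exact: loop_catVr.
Qed.

HB.instance Definition _ := isGroup.Build pi1
  pi1_mulA pi1_mul1g pi1_mulg1 pi1_mulVg pi1_mulgV.

End fundamental_group.
Arguments pi1 R {Y} p.

Section induced_map.
Context {R : realType} {X Y : topologicalType} (x : X) (y : Y).
Context (r : continuousType X Y) (rxy : r x = y).

Let loop_map_continuous (f : loop_space R x) : continuous (r \o f).
Proof. by move=> t; apply: continuous_comp; exact: cts_fun. Qed.

Let loop_map_zero (f : loop_space R x) : (r \o f) zero = y.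
Proof. by rewrite /= path_zero. Qed.

Let loop_map_one (f : loop_space R x) : (r \o f) one = y.
Proof. by rewrite /= path_one. Qed.

Definition loop_map (f : loop_space R x) : loop_space R y :=
  mk_path (@loop_map_continuous f) (loop_map_zero f) (loop_map_one f).

Lemma loop_mapE (f : loop_space R x) t : loop_map f t = r (f t).
Proof. by []. Qed.

Definition pi1_map (a : pi1 R x) : pi1 R y := loop_class (loop_map (repr a)).

Lemma loop_map_homotopic (f g : loop_space R x) :
  loop_homotopic f g -> loop_homotopic (loop_map f) (loop_map g).
Proof.
case=> H [cH H0 H1 Hl Hr]; exists (r \o H); split=> /= [z|s|s|t|t].
- by apply: continuous_comp; [exact: cH|exact: cts_fun].
- by rewrite H0.
- by rewrite H1.
- by rewrite Hl.
- by rewrite Hr.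
Qed.

Lemma pi1_mapE (f : loop_space R x) :
  pi1_map (loop_class f) = loop_class (loop_map f).
Proof. by apply/loop_classP/loop_map_homotopic; exact: repr_loop_class. Qed.

Lemma pi1_mapM : {morph pi1_map : a b / (a * b)%g}.
Proof.
move=> a b; rewrite -(loop_class_repr a) -(loop_class_repr b).
rewrite [(loop_class _ * _)%g]pi1_mulE !pi1_mapE.
rewrite [RHS]pi1_mulE; congr loop_class; apply/path_eqP => t.
by rewrite loop_mapE !loop_catE (fun_if r).
Qed.

End induced_map.

Section hawaiian_earring.
Context (R : realType).

Definition earring_circle (i : nat) : set (R * R) :=
  [set z | (z.1 - i%:R^-1) ^+ 2 + z.2 ^+ 2 = i%:R^-1 ^+ 2].

Definition earring_stage (n : nat) : set (R * R) :=
  \bigcup_(i in [set i | (1 <= i <= n)%N]) earring_circle i.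

Definition earring : set (R * R) :=
  \bigcup_(n in [set n | (1 <= n)%N]) earring_stage n.

Lemma origin_circle i : earring_circle i (0, 0).
Proof. by rewrite /earring_circle /= sub0r sqrrN expr0n addr0. Qed.

Lemma origin_stage_subproof n : ((0, 0) : R * R) \in earring_stage n.+1.
Proof. by apply/mem_set; exists 1%N => //; exact: origin_circle. Qed.

Lemma stage_earring n : earring_stage n.+1 `<=` earring.
Proof. by move=> z zn; exists n.+1. Qed.

Lemma origin_earring_subproof : ((0, 0) : R * R) \in earring.
Proof.
by apply/mem_set/(@stage_earring 0)/set_mem; exact: origin_stage_subproof.
Qed.

Definition earring_origin : earring :=
  exist (fun z => z \in earring) (0, 0) origin_earring_subproof.

Definition stage_origin n : earring_stage n.+1 :=
  exist (fun z => z \in earring_stage n.+1) (0, 0) (origin_stage_subproof n).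

(* The map that fixes the first n+1 circles pointwise and sends every other
   point to the origin, on an arbitrary subset A of the plane *)
Definition collapse (A : set (R * R)) n (z : A) : earring_stage n.+1 :=
  match pselect (\val z \in earring_stage n.+1) with
  | left zn => exist (fun z => z \in earring_stage n.+1) (\val z) zn
  | right _ => stage_origin n
  end.

Lemma collapse_id (A : set (R * R)) n (z : A) :
  earring_stage n.+1 (\val z) -> \val (collapse n z) = \val z.
Proof.
by move=> zn; rewrite /collapse; case: pselect => // -[]; exact: mem_set.
Qed.

Lemma collapse_notin (A : set (R * R)) n (z : A) :
  ~ earring_stage n.+1 (\val z) -> \val (collapse n z) = (0, 0).
Proof.
by move=> zn; rewrite /collapse; case: pselect => // zn'; case: zn; exact: set_mem.
Qed.

Lemma circleE i (z : R * R) : (0 < i)%N -> earring_circle i z ->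
  i%:R * (z.1 ^+ 2 + z.2 ^+ 2) = 2 * z.1.
Proof.
move=> i0; rewrite /earring_circle /= => zi.
have i0' : (i%:R : R) != 0 by rewrite pnatr_eq0 -lt0n.
have -> : z.1 ^+ 2 + z.2 ^+ 2 = 2 * z.1 * i%:R^-1.
  by move: zi; set a := i%:R^-1 => zi; nra.
by rewrite mulrCA divff ?mulr1.
Qed.

Lemma sqr_sum_gt0 (z : R * R) : z != (0, 0) -> 0 < z.1 ^+ 2 + z.2 ^+ 2.
Proof.
move=> z0; rewrite lt_neqAle eq_sym addr_ge0 ?sqr_ge0 // andbT.
apply: contra z0; rewrite paddr_eq0 ?sqr_ge0 // !sqrf_eq0.
by case: z => a b /= /andP[/eqP -> /eqP ->].
Qed.

Lemma earring_ge_stage n (z : R * R) : earring z ->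
  2 * z.1 < n.+2%:R * (z.1 ^+ 2 + z.2 ^+ 2) -> earring_stage n.+1 z.
Proof.
case=> m _ [i /= /andP[i0 _] zi]; rewrite -(circleE i0 zi) => lti.
exists i => //=; rewrite i0 /= -ltnS -(ltr_nat R).
have z0 : 0 <= z.1 ^+ 2 + z.2 ^+ 2 by rewrite addr_ge0 ?sqr_ge0.
rewrite ltNge; apply/negP => /(ler_wpM2r z0).
by rewrite leNgt lti.
Qed.

Lemma stage_le n (z : R * R) : earring_stage n z ->
  2 * z.1 <= n%:R * (z.1 ^+ 2 + z.2 ^+ 2).
Proof.
case=> i /= /andP[i0 lei] zi; rewrite -(circleE i0 zi).
by rewrite ler_wpM2r ?addr_ge0 ?sqr_ge0 // ler_nat.
Qed.

Lemma earring_stageP n (z : R * R) : earring z ->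
  2 * z.1 <= n.+1%:R * (z.1 ^+ 2 + z.2 ^+ 2) -> earring_stage n.+1 z.
Proof.
move=> ez le1; have [->|z0] := eqVneq z (0, 0).
  exact/set_mem/origin_stage_subproof.
apply: earring_ge_stage => //; apply: (le_lt_trans le1).
by rewrite ltr_pM2r ?sqr_sum_gt0 // ltr_nat.
Qed.

Lemma collapse_circle (A : set (R * R)) n i (z : A) :
  (n.+1 < i)%N -> earring_circle i (\val z) ->
  collapse n z = stage_origin n.
Proof.
move=> ni zi; apply/val_inj => /=.
have [z0|z0] := eqVneq (\val z) (0, 0).
  by rewrite collapse_id z0 //; exact/set_mem/origin_stage_subproof.
apply: collapse_notin => zs; have := stage_le zs; apply/negP.
rewrite -ltNge -(circleE _ zi) ?(leq_ltn_trans _ ni) //.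
by rewrite ltr_pM2r ?sqr_sum_gt0 // ltr_nat.
Qed.

Lemma earring_form_continuous {T : topologicalType} (u v : T -> R) (c : R) :
  continuous u -> continuous v ->
  continuous (fun z => c * (u z ^+ 2 + v z ^+ 2) - 2 * u z).
Proof.
move=> cu cv z; apply: cvgB; last by apply: cvgM; [exact: cvg_cst|exact: cu].
apply: cvgM; first exact: cvg_cst.
by apply: cvgD; apply: cvgM; (exact: cu || exact: cv).
Qed.

Lemma collapse_continuous (A : set (R * R)) n :
  A `<=` earring -> continuous (@collapse A n).
Proof.
move=> sAE; apply: continuous_set_type => z.
have cval : continuous (\val : A -> R * R) by exact: set_val_continuous.
have c1 : continuous (fun z : A => (\val z).1).
  by move=> w; apply: (@continuous_comp _ _ _ (\val : A -> R * R) fst);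
    [exact: cval|exact: cvg_fst].
have c2 : continuous (fun z : A => (\val z).2).
  by move=> w; apply: (@continuous_comp _ _ _ (\val : A -> R * R) snd);
    [exact: cval|exact: cvg_snd].
have cq (c : R) : continuous (fun z : A =>
    c * ((\val z).1 ^+ 2 + (\val z).2 ^+ 2) - 2 * (\val z).1).
  exact: earring_form_continuous.
have Az : earring (\val z) by apply/sAE/set_mem/valP.
have EA (w : A) : earring (\val w) by apply/sAE/set_mem/valP.
have [z0|z0] := eqVneq (\val z) (0, 0).
  have cz : (\val \o @collapse A n) z = (0, 0).
    by rewrite /= collapse_id z0 //; exact/set_mem/origin_stage_subproof.
  rewrite /continuous_at cz => U U0.
  have : nbhs z (\val @^-1` U) by apply: cval; rewrite z0.
  apply: filterS => w /= Uw.
  have [wn|wn] := pselect (earring_stage n.+1 (\val w)).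
    by rewrite collapse_id.
  by rewrite collapse_notin //; exact: nbhs_singleton.
have [zn|zn] := pselect (earring_stage n.+1 (\val z)).
  have q0 : 0 < n.+2%:R * ((\val z).1 ^+ 2 + (\val z).2 ^+ 2) - 2 * (\val z).1.
    rewrite subr_gt0 (le_lt_trans (stage_le zn)) //.
    by rewrite ltr_pM2r ?sqr_sum_gt0 // ltr_nat.
  have nq : \forall w \near z,
      0 < n.+2%:R * ((\val w).1 ^+ 2 + (\val w).2 ^+ 2) - 2 * (\val w).1.
    by exact: cq n.+2%:R z _ (lt_nbhsr q0).
  rewrite /continuous_at /= collapse_id // => U Uz.
  have Uval : \forall w \near z, U (\val w) by exact: cval z U Uz.
  suff : \forall w \near z, U (\val (collapse n w)) by [].
  near=> w.
  have qw : 0 < n.+2%:R * ((\val w).1 ^+ 2 + (\val w).2 ^+ 2) - 2 * (\val w).1.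
    by near: w.
  have Uw : U (\val w) by near: w.
  by rewrite collapse_id //; apply: earring_ge_stage => //; rewrite -subr_gt0.
have q0 : n.+1%:R * ((\val z).1 ^+ 2 + (\val z).2 ^+ 2) - 2 * (\val z).1 < 0.
  rewrite subr_lt0 ltNge; apply/negP => le1.
  by apply: zn; exact: earring_stageP.
have nq : \forall w \near z,
    n.+1%:R * ((\val w).1 ^+ 2 + (\val w).2 ^+ 2) - 2 * (\val w).1 < 0.
  by exact: cq n.+1%:R z _ (lt_nbhsl q0).
rewrite /continuous_at /= collapse_notin // => U Uz.
apply: filterS nq => w /= qw.
rewrite collapse_notin; first exact: nbhs_singleton.
by move=> /stage_le; rewrite -subr_ge0 leNgt qw.
Unshelve. all: by end_near. Qed.

(* [earring_retract n] is R_(n+1) : X -> X_(n+1), and [stage_retract n] is the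
   bonding retraction X_(n+2) -> X_(n+1). *)
Definition earring_retract n : earring -> earring_stage n.+1 :=
  @collapse earring n.

Definition stage_retract n : earring_stage n.+2 -> earring_stage n.+1 :=
  @collapse (earring_stage n.+2) n.

HB.instance Definition _ n := @isContinuous.Build _ _ (earring_retract n)
  (@collapse_continuous earring n (@subset_refl _ _)).

HB.instance Definition _ n := @isContinuous.Build _ _ (@stage_retract n)
  (@collapse_continuous (earring_stage n.+2) n (@stage_earring n.+1)).

Lemma earring_retract_origin n :
  earring_retract n earring_origin = stage_origin n.
Proof.
by apply: (@collapse_circle earring n n.+2) => //; exact: origin_circle.
Qed.

Lemma stage_retract_origin n :
  stage_retract (stage_origin n.+1) = stage_origin n.
Proof.
apply: (@collapse_circle (earring_stage n.+2) n n.+2) => //.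
exact: origin_circle.
Qed.

Lemma stage_retract_comp n (z : earring) :
  stage_retract (earring_retract n.+1 z) = earring_retract n z.
Proof.
apply: val_inj; rewrite /stage_retract /earring_retract.
have [zn|zn] := pselect (earring_stage n.+1 (\val z)).
  have zn1 : earring_stage n.+2 (\val z).
    by case: zn => i /= /andP[i0 lei] zi; exists i => //=; rewrite i0 leqW.
  by rewrite (collapse_id zn) collapse_id ?collapse_id // collapse_id.
rewrite (collapse_notin zn).
have [zn1|zn1] := pselect (earring_stage n.+2 (\val z)).
  by rewrite collapse_notin // collapse_id.
rewrite collapse_id collapse_notin //.
exact/set_mem/origin_stage_subproof.
Qed.

Definition pi1_stage n : topologicalType := pi1 R (stage_origin n).

Definition pi1_bond n : pi1_stage n.+1 -> pi1_stage n :=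
  pi1_map (stage_retract_origin n).

Definition pi1_limit : set (prod_topology pi1_stage) := inverse_limit pi1_bond.

Definition pi1_sequence (a : pi1 R earring_origin) : prod_topology pi1_stage :=
  fun n => pi1_map (earring_retract_origin n) a.

Lemma pi1_sequence_limit a : pi1_sequence a \in pi1_limit.
Proof.
apply/mem_set => n; rewrite /pi1_sequence -(reprK a) /pi1_bond.
rewrite -!/(loop_class _) !pi1_mapE; congr loop_class; apply/path_eqP => t.
exact: stage_retract_comp.
Qed.

Definition canonical_injection (a : pi1 R earring_origin) : pi1_limit :=
  exist (fun s => s \in pi1_limit) (pi1_sequence a) (pi1_sequence_limit a).

Lemma canonical_injectionE (f : loop_space R earring_origin) n :
  \val (canonical_injection (loop_class f)) n =
  loop_class (loop_map (earring_retract_origin n) f).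
Proof. exact: pi1_mapE. Qed.

End hawaiian_earring.

(* Main.v *)
Require Import Defs.
From mathcomp Require Import all_boot all_order all_algebra.
From mathcomp Require Import all_classical reals topology.
From mathcomp Require Import normedtype homotopy interval_inference.
From mathcomp Require Import sequences trigo ring lra zify.

Set Implicit Arguments.
Unset Strict Implicit.
Unset Printing Implicit Defensive.

Import Order.TTheory GRing.Theory Num.Theory.
Import numFieldNormedType.Exports.

Local Open Scope classical_set_scope.
Local Open Scope ring_scope.

(** Let x_i be the loop running once around the i-th circle and consider the
    classes y_n = x_1^n x_(n+2) x_1^(-n).  The retraction onto the first k
    circles kills y_n as soon as k < n + 2, so phi (y_n) tends to phi (1).  If
    the inverse of phi were continuous on the image, y_n would tend to 1 in
    pi_1(X).  It does not, because a loop representing y_n has to turn n times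
    around the first circle before it goes around a much smaller one, whereas
    all loops uniformly close to a given loop make a bounded number of turns
    around the first circle.

    To make this precise, unroll the first circle: in the infinite cyclic cover
    of X, a line with the smaller circles attached at each integer point, count
    how many times the lift of a loop goes around the copy of the (n+2)-nd
    circle at the integer n.  This diagonal winding number is a homotopy
    invariant, equal to 1 on y_n and to 0 on the trivial class.  The classes on
    which it vanishes for every n form an open set [no_diagonal_winding]: near a
    loop f, the numbers with n large vanish by the bound on the turns
    ([holonomy_far]), and the finitely many others are locally constant
    ([holonomy_near]).  So this set is a neighbourhood of 1 that misses all y_n.

    No covering space is built.  A pair (k, w), sheet and winding number, is
    carried along a loop by a map [wind_step n x y] of int * int for each pair
    of points; it records whether the far end of the first or the (n+2)-nd
    circle is crossed between x and y.  Every point has a neighbourhood on which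
    these maps compose, and this alone gives a holonomy along loops, computed on
    fine dyadic subdivisions, that is homotopy invariant, locally constant and
    compatible with concatenation. *)

(** * Transport along finite chains of points *)

Section transport.
Context {Y S : Type} (step : Y -> Y -> S -> S).
Implicit Types (x y : nat -> Y) (O : set Y) (s : S) (N D : nat).

(** The maps [step a b] form a flat connection on O: inside O, the transport
    does not depend on the intermediate points. *)
Definition flat O : Prop :=
  (forall a s, O a -> step a a s = s) /\
  forall a b c s, O a -> O b -> O c -> step b c (step a b s) = step a c s.

Fixpoint transport x N s : S :=
  if N is k.+1 then step (x k) (x k.+1) (transport x k s) else s.

Lemma eq_transport x y N s :
  (forall k, (k <= N)%N -> x k = y k) -> transport x N s = transport y N s.
Proof.
elim: N => //= N IHN xy; rewrite IHN ?xy // => k kN; apply: xy; exact: leqW.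
Qed.

Lemma transport_cat x N D s :
  transport x (N + D) s =
  transport (fun k => x (N + k)%N) D (transport x N s).
Proof. by elim: D => [|D IHD]; rewrite ?addn0 //= addnS /= IHD. Qed.

Lemma transport_flat x O N s : flat O -> (forall k, (k <= N)%N -> O (x k)) ->
  transport x N s = step (x 0%N) (x N) s.
Proof.
move=> [O1 OM]; elim: N => [|N IHN] Ox; first by rewrite O1 //; exact: Ox.
by rewrite /= IHN => [|k kN]; [apply: OM; exact: Ox|apply: Ox; exact: leqW].
Qed.

(** Stated for a block cut short after r steps, because bounding the turns of a
    loop requires the states at all nodes, not only at the ends of blocks. *)
Lemma transport_block x D j r s O : flat O ->
  (forall i, (j * D <= i <= j.+1 * D)%N -> O (x i)) -> (r <= D)%N ->
  transport x (j * D + r) s =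
  step (x (j * D)%N) (x (j * D + r)%N) (transport x (j * D) s).
Proof.
move=> fO Ox rD; rewrite transport_cat.
rewrite (@transport_flat (fun k => x (j * D + k)%N) O) ?addn0 //.
move=> k kr; apply: Ox; rewrite leq_addr mulSn addnC leq_add2r.
exact: leq_trans kr rD.
Qed.

Lemma transport_coarsen x N D s :
  (forall j, (j < N)%N ->
    exists2 O, flat O & forall i, (j * D <= i <= j.+1 * D)%N -> O (x i)) ->
  transport x (N * D) s = transport (fun j => x (j * D)%N) N s.
Proof.
elim: N => [|N IHN] xO; first by rewrite mul0n.
have [O fO Ox] := xO N (ltnSn N).
rewrite mulSn addnC (transport_block _ fO) //= IHN ?mulSn 1?addnC // => j jN.
by apply: xO; exact: ltnW.
Qed.

(** The homotopy principle: a ladder between two chains, each of whose cells is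
    flat, commutes. *)
Lemma transport_ladder x y N s :
  (forall k, (k < N)%N -> exists2 O, flat O &
    [/\ O (x k), O (x k.+1), O (y k) & O (y k.+1)]) ->
  step (x N) (y N) (transport x N s) =
  transport y N (step (x 0%N) (y 0%N) s).
Proof.
elim: N => [//|N IHN] xy /=.
have [O [_ OM] [Ox Ox' Oy Oy']] := xy N (ltnSn N).
by rewrite -IHN => [|k kN]; [rewrite !OM|apply: xy; exact: ltnW].
Qed.

End transport.

(** * Dyadic subdivisions of the unit interval *)

Section dyadic.
Context {R : realType}.
Local Notation I := (unit_interval R).

Definition dyadic (m k : nat) : I := unit_proj (k%:R / 2 ^+ m).

Definition dyadic_block (m j : nat) : set I :=
  [set t | j%:R / 2 ^+ m <= unit_val t <= j.+1%:R / 2 ^+ m].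

Lemma dyadicE m k : (k <= 2 ^ m)%N -> unit_val (dyadic m k) = k%:R / 2 ^+ m.
Proof.
move=> km; rewrite unit_projE // ler_pdivrMr ?exprn_gt0 // mul1r -natrX ler_nat.
by rewrite divr_ge0.
Qed.

Lemma dyadic0 m : dyadic m 0 = zero.
Proof. by apply: unit_proj0; rewrite mul0r. Qed.

Lemma dyadic1 m : dyadic m (2 ^ m) = one.
Proof. by apply: unit_proj1; rewrite natrX divff ?expf_neq0 ?pnatr_eq0. Qed.

Lemma dyadic_scale m d k :
  k%:R / 2 ^+ m = (k * 2 ^ d)%N%:R / (2 ^+ m * 2 ^+ d) :> R.
Proof.
by rewrite natrM natrX -mulf_div divff ?expf_neq0 ?pnatr_eq0 // mulr1.
Qed.

Lemma dyadic_coarse m d k : dyadic (m + d) (k * 2 ^ d) = dyadic m k.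
Proof. by rewrite /dyadic (dyadic_scale m d) exprD. Qed.

Lemma dyadic_in_block m d j i : (j < 2 ^ m)%N ->
  (j * 2 ^ d <= i <= j.+1 * 2 ^ d)%N -> dyadic_block m j (dyadic (m + d) i).
Proof.
move=> jm /andP[ji ij].
rewrite /dyadic_block /= dyadicE; last first.
  by rewrite expnD (leq_trans ij) // leq_mul2r jm orbT.
by rewrite !(dyadic_scale m d) -exprD !ler_pM2r ?invr_gt0 ?exprn_gt0 //
  !ler_nat ji.
Qed.

Lemma dyadic_block_refine m d j i : (i < 2 ^ d)%N ->
  dyadic_block (m + d) (j * 2 ^ d + i) `<=` dyadic_block m j.
Proof.
move=> id t; rewrite /dyadic_block /= exprD => /andP[lt tl].
rewrite !(dyadic_scale m d); apply/andP; split;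
  [apply: le_trans lt|apply: (le_trans tl)].
  by rewrite ler_pM2r ?invr_gt0 ?mulr_gt0 ?exprn_gt0 // ler_nat leq_addr.
rewrite ler_pM2r ?invr_gt0 ?mulr_gt0 ?exprn_gt0 // ler_nat mulSn addnC.
by rewrite -addSn leq_add2r.
Qed.

(** The Lebesgue number lemma on the square: by compactness, a property that
    each point of Y has on one of its neighbourhoods holds for a set around the
    image of every cell of a fine enough dyadic grid. *)
Lemma lebesgue_dyadic {Y : topologicalType} (P : set (set Y))
    (H : I * I -> Y) : continuous H ->
  (forall y : Y, exists2 O : set Y, nbhs y O & P O) ->
  \forall m \near \oo, forall i j, (i < 2 ^ m)%N -> (j < 2 ^ m)%N ->
    exists2 O, P O & forall t, dyadic_block m i t.1 ->
      dyadic_block m j t.2 -> O (H t).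
Proof.
move=> cH PO.
(* Balls are taken in the plane, where the square is a compact product. *)
pose G (z : R * R) := H (unit_proj z.1, unit_proj z.2).
have cG : continuous G.
  apply: (continuousT_comp _ cH); apply: continuousT_pair => z.
    exact: (continuousT_comp (fun z => cvg_fst) (@unit_proj_continuous R)).
  exact: (continuousT_comp (fun z => cvg_snd) (@unit_proj_continuous R)).
have K : compact (`[0 : R, 1] `*` `[0 : R, 1]).
  by apply: compact_setX; exact: segment_compact.
have /compact_near_coveringP/(_ nat \oo (fun m z =>
    exists2 O, P O & forall w, ball z (2 ^- m) w -> O (G w)) _) cov := K.
have : \forall m \near \oo, `[0, 1] `*` `[0, 1] `<=`
    [set z | exists2 O, P O & forall w, ball z (2 ^- m) w -> O (G w)].
  apply: cov => z _; have [O Oz PO'] := PO (G z).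
  have /nbhs_ballP[e /= e0 eO] : nbhs z (G @^-1` O) by exact: cG.
  have e2 : 0 < e / 2 by rewrite divr_gt0.
  near=> w m => /=; exists O => // v wv; apply: eO.
  rewrite [e]splitr; apply: (@ball_triangle _ _ w).
    by near: w; exact: nbhsx_ballx.
  apply: le_ball wv; rewrite -div1r ltW //; near: m.
  exact: near_infty_natSinv_expn_lt (PosNum e2).
(* The balls are open and the cells closed, hence the shift from m to m - 1. *)
move=> [M _ MP]; exists M.+1 => // m /= Mm i j im jm.
have /(MP m.-1) /(_ (i%:R / 2 ^+ m, j%:R / 2 ^+ m)) [] : (M <= m.-1)%N by lia.
  split; rewrite /= in_itv /= divr_ge0 ?exprn_ge0 //=;
    by rewrite ler_pdivrMr ?exprn_gt0 // mul1r -natrX ler_nat ltnW.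
move=> O PO' Om; exists O => // -[s t] /= /andP[si is_] /andP[tj jt].
have := Om (unit_val s, unit_val t); rewrite /G /= !unit_valK; apply.
have h : (2 ^- m : R) < 2 ^- m.-1.
  by rewrite ltf_pV2 ?posrE ?exprn_gt0 // ltr_eXn2l ?ltr1n //; lia.
move: is_ jt; rewrite -(natr1 i) -(natr1 j) !mulrDl !mul1r => is_ jt.
split; rewrite /ball /= ltr_norml; apply/andP; split; lra.
Unshelve. all: by end_near. Qed.

Lemma lebesgue_dyadic1 {Y : topologicalType} (P : set (set Y)) (f : I -> Y) :
  continuous f -> (forall y : Y, exists2 O : set Y, nbhs y O & P O) ->
  \forall m \near \oo, forall i, (i < 2 ^ m)%N ->
    exists2 O, P O & forall t, dyadic_block m i t -> O (f t).
Proof.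
move=> cf PO; have [] := @lebesgue_dyadic _ P (f \o fst) _ PO.
  by apply: (continuousT_comp _ cf) => z; exact: cvg_fst.
move=> M _ MP; exists M => // m /= Mm i im.
have [O PO' fO] := MP m Mm i i im im; exists O => // t ti.
exact: (fO (t, t)).
Qed.

Lemma dyadic_end_in_block m i : (i < 2 ^ m)%N ->
  dyadic_block m i (dyadic m i) /\ dyadic_block m i (dyadic m i.+1).
Proof.
move=> im; split; rewrite -{2}(addn0 m); apply: dyadic_in_block => //;
  by rewrite expn0 !muln1; lia.
Qed.

Lemma dyadic_block_compact m i :
  (i < 2 ^ m)%N -> compact (dyadic_block m i).
Proof.
move=> im; have -> : dyadic_block m i =
    unit_proj @` `[i%:R / 2 ^+ m, i.+1%:R / 2 ^+ m].
  apply/seteqP; split=> [t ti|_ [u + <-]].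
    by exists (unit_val t); rewrite ?unit_valK //= in_itv.
  rewrite /= in_itv /dyadic_block /= => iu.
  have ge0 : 0 <= i%:R / 2 ^+ m :> R by rewrite divr_ge0 ?exprn_ge0.
  have le1 : i.+1%:R / 2 ^+ m <= 1 :> R.
    by rewrite ler_pdivrMr ?exprn_gt0 // mul1r -natrX ler_nat.
  by case/andP: (iu) => iu0 iu1; rewrite unit_projE //; apply/andP; split; lra.
apply: continuous_compact; last exact: segment_compact.
by apply: continuous_subspaceT; exact: unit_proj_continuous.
Qed.

End dyadic.

(** * Holonomy of a locally flat step *)

Section holonomy.
Context {R : realType} {Y : topologicalType} {S : Type}.
Context (step : Y -> Y -> S -> S).
Local Notation I := (unit_interval R).
Implicit Types (s : S) (m d : nat) (p : Y).

Definition locally_flat : Prop :=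
  forall y : Y, exists2 O : set Y, nbhs y O & flat step O.

(** On a fine subdivision every block of f lies in a flat set, so that further
    subdivision does not change the transport along f. *)
Definition fine m (f : I -> Y) : Prop :=
  forall i, (i < 2 ^ m)%N ->
    exists2 O, flat step O & forall t, dyadic_block m i t -> O (f t).

Definition dyadic_transport m (f : I -> Y) s : S :=
  transport step (fun k => f (dyadic m k)) (2 ^ m) s.

(** A continuous f is fine at some level ([fine_near_infty]), and by
    [holonomyE] every fine level gives the same value. *)
Definition holonomy (f : I -> Y) s : S :=
  dyadic_transport (xget 0%N [set m | fine m f]) f s.

Lemma fine_refine m d f : fine m f -> fine (m + d) f.
Proof.
move=> fm i im; have d0 : (0 < 2 ^ d)%N by rewrite expn_gt0.
have [|O fO Of] := fm (i %/ 2 ^ d)%N; first by rewrite ltn_divLR // -expnD.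
exists O => // t ti; apply: Of.
apply: (@dyadic_block_refine _ m d _ (i %% 2 ^ d)).
  by rewrite ltn_mod.
by rewrite -divn_eq.
Qed.

Lemma dyadic_transport_refine m d f s : fine m f ->
  dyadic_transport (m + d) f s = dyadic_transport m f s.
Proof.
move=> fm; rewrite /dyadic_transport expnD transport_coarsen => [|j jm].
  by apply: eq_transport => k _; rewrite dyadic_coarse.
have [O fO Of] := fm j jm; exists O => // i ij; apply: Of.
exact: dyadic_in_block.
Qed.

Lemma holonomyE m f s : fine m f -> holonomy f s = dyadic_transport m f s.
Proof.
move=> fm; have /= := @xgetI _ 0%N [set m | fine m f] m fm.
rewrite /holonomy; move: (xget _ _) => n fn.
by rewrite -(dyadic_transport_refine m _ fn) addnC dyadic_transport_refine.
Qed.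

Section flat_step.
Hypothesis step_flat : locally_flat.

Lemma step_refl p s : step p p s = s.
Proof.
have [O Op fO] := step_flat p; apply: fO.1; exact: nbhs_singleton Op.
Qed.

Lemma fine_near_infty f : continuous f -> \forall m \near \oo, fine m f.
Proof. by move=> cf; exact: lebesgue_dyadic1. Qed.

Lemma holonomy_const p s : holonomy (loop_const p : loop_space R p) s = s.
Proof.
have [O Op fO] := step_flat p.
have f0 : fine 0 (loop_const p : loop_space R p).
  by move=> i _; exists O => // t _; exact: nbhs_singleton.
by rewrite (holonomyE _ f0) /dyadic_transport /= step_refl.
Qed.

(** Cut the homotopy into cells with flat images.  Consecutive rows of the grid
    are related by a ladder whose two outer rungs are trivial, the homotopy
    being constant on the vertical sides. *)
Lemma holonomy_homotopic p (f g : loop_space R p) s :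
  loop_homotopic f g -> holonomy f s = holonomy g s.
Proof.
move=> [H [cH Hf Hg H0 H1]].
have [M _ HM] := lebesgue_dyadic cH step_flat.
pose h l t := H (t, dyadic M l).
have hE l s' : (l <= 2 ^ M)%N ->
    dyadic_transport M (h l) s' = dyadic_transport M (h 0%N) s'.
  elim: l => // l IHl lM; rewrite -IHl ?(ltnW lM) //.
  have := @transport_ladder _ _ step (fun k => h l (dyadic M k))
    (fun k => h l.+1 (dyadic M k)) (2 ^ M) s'.
  rewrite /dyadic_transport /h !dyadic0 !dyadic1 !H0 !H1 !step_refl.
  move=> -> // k kM.
  have [O fO Ok] := HM M (leqnn M) k l kM lM.
  have [k0 k1] := @dyadic_end_in_block R M k kM.
  have [l0 l1] := @dyadic_end_in_block R M l lM.
  by exists O => //; split; apply: Ok.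
have row l : (l <= 2 ^ M)%N -> fine M (h l).
  move=> lM i iM; have [j jM lj] : exists2 j, (j < 2 ^ M)%N &
      @dyadic_block R M j (dyadic M l).
    have M0 : (0 < 2 ^ M)%N by rewrite expn_gt0.
    case: l lM => [|l] lM; [exists 0%N|exists l] => //.
      exact: (dyadic_end_in_block M0).1.
    exact: (dyadic_end_in_block lM).2.
  have [O fO Oi] := HM M (leqnn M) i j iM jM.
  by exists O => // t ti; exact: Oi.
have h0 : h 0%N = f by apply/funext => t; rewrite /h dyadic0 Hf.
have h1 : h (2 ^ M)%N = g by apply/funext => t; rewrite /h dyadic1 Hg.
rewrite -h0 -h1 (holonomyE _ (row 0%N _)) // (holonomyE _ (row (2 ^ M)%N _)) //.
by rewrite hE.
Qed.

(** This is where the compact-open topology enters: a loop sends each of the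
    finitely many compact dyadic blocks into an open flat set, and so do all
    loops near it. *)
Lemma common_flat_cover p (f : loop_space R p) : exists m, \forall g \near f,
  forall i, (i < 2 ^ m)%N -> exists2 O, flat step O &
    forall t, dyadic_block m i t -> O (f t) /\ O ((g : loop_space R p) t).
Proof.
have cf : continuous f := @cts_fun _ _ f.
have [y|m _ fm] := lebesgue_dyadic1 cf (P := [set O | open O /\ flat step O]).
  have [O + [fO1 fOM]] := step_flat y; rewrite nbhsE => -[O' [oO' O'y] sub].
  exists O'; first by exists O'.
  by split=> //; split=> *; [apply: fO1|apply: fOM]; exact: sub.
exists m.
suff : \forall g \near f, forall i : 'I_(2 ^ m), exists2 O, flat step O &
    forall t, dyadic_block m i t -> O (f t) /\ O ((g : loop_space R p) t).
  by apply: filterS => g gP i im; exact: (gP (Ordinal im)).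
apply: (@filter_forall _ _ _ _ (nbhs_filter (f : loop_space R p))).
move=> i; have [O [oO fO] Of] := fm m (leqnn m) i (ltn_ord i).
have K := @dyadic_block_compact R m i (ltn_ord i).
have Uf : nbhs (f : {compact-open, I -> Y})
    [set g | g @` dyadic_block m i `<=` O].
  apply: open_nbhs_nbhs; split; first exact: compact_open_open.
  by move=> _ [t ti <-]; exact: Of.
have := @initial_continuous (loop_space R p) {compact-open, I -> Y} id f _ Uf.
apply: (@filterS _ _ (nbhs_filter (f : loop_space R p))) => g gO.
exists O => // t ti.
by split; [exact: Of|apply: gO; exists t].
Qed.

(** A single level m serves for all loops near f.  This uniformity is what
    bounds their number of turns around the first circle. *)
Lemma fine_near p (f : loop_space R p) :
  exists m, \forall g \near f, fine m (g : loop_space R p).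
Proof.
have [m mP] := common_flat_cover f; exists m; apply: filterS mP => g gP i im.
by have [O fO Og] := gP i im; exists O => // t /Og[].
Qed.

(** Again a ladder: f and a nearby g run through the same flat sets, and their
    common base point makes the outer rungs trivial. *)
Lemma holonomy_near p (f : loop_space R p) :
  \forall g \near f, forall s, holonomy (g : loop_space R p) s = holonomy f s.
Proof.
have [m mP] := common_flat_cover f; apply: filterS mP => g gP s.
have fg : fine m g.
  by move=> i im; have [O fO Og] := gP i im; exists O => // t /Og[].
have ff : fine m f.
  by move=> i im; have [O fO Og] := gP i im; exists O => // t /Og[].
rewrite (holonomyE _ fg) (holonomyE _ ff).
have := @transport_ladder _ _ step (fun k => f (dyadic m k))
    (fun k => g (dyadic m k)) (2 ^ m) s.
rewrite !dyadic0 !dyadic1 !path_zero !path_one !step_refl /dyadic_transport.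
move=> -> //.
move=> k km; have [O fO Ok] := gP k km; exists O => //.
have [k0 k1] := @dyadic_end_in_block R m k km.
by have [? ?] := Ok _ k0; have [? ?] := Ok _ k1; split.
Qed.

Lemma holonomy_cat p (f g : loop_space R p) s :
  holonomy (loop_cat f g) s = holonomy g (holonomy f s).
Proof.
have : \forall m \near \oo, [/\ fine m f, fine m g & fine m (loop_cat f g)].
  have F (h : loop_space R p) := fine_near_infty (@cts_fun _ _ h).
  by near=> m; split; near: m; exact: F.
move=> [m _ /(_ m (leqnn m))[fm gm cm]].
have {}cm : fine m.+1 (loop_cat f g) by rewrite -addn1; exact: fine_refine.
rewrite (holonomyE _ fm) (holonomyE _ gm) (holonomyE _ cm).
rewrite /dyadic_transport expnS mul2n -addnn transport_cat.
have half (k : nat) : 2 * (k%:R / 2 ^+ m.+1) = k%:R / 2 ^+ m :> R.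
  by rewrite exprS invfM mulrCA mulVKf ?pnatr_eq0.
have e1 k : (k <= 2 ^ m)%N -> loop_cat f g (dyadic m.+1 k) = f (dyadic m k).
  move=> km; rewrite loop_catE dyadicE ?expnS; last first.
    by rewrite (leq_trans km) // leq_pmull.
  rewrite ifT; first by rewrite half.
  by rewrite -(ler_pM2l (ltr0n R 2)) half divff ?pnatr_eq0 // ler_pdivrMr
    ?exprn_gt0 // mul1r -natrX ler_nat.
rewrite (@eq_transport _ _ step _ (fun k => f (dyadic m k)) (2 ^ m) _ e1).
apply: eq_transport => k km.
case: k km => [|k] km.
  by rewrite addn0 e1 // dyadic1 path_one dyadic0 path_zero.
rewrite loop_catE dyadicE ?ifF.
- congr (g (unit_proj _)); rewrite half natrD natrX mulrDl divff ?expf_neq0 //.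
  by rewrite addrAC subrr add0r.
- apply/negbTE; rewrite -ltNge -(ltr_pM2l (ltr0n R 2)) half divff ?pnatr_eq0 //.
  by rewrite ltr_pdivlMr ?exprn_gt0 // mul1r -natrX ltr_nat; lia.
- by rewrite expnS mul2n -addnn leq_add2l.
Unshelve. all: by end_near. Qed.

End flat_step.
End holonomy.

(** * Counting the crossings of the far ends of two circles *)

Section crossing.
Context {R : realType}.
Implicit Types (z w : R * R) (i n m d : nat).
Local Notation I := (unit_interval R).
Local Notation X := (set_type (@earring R)).

(** A vertical strip around the far end (2 / (i+1), 0) of the circle of radius
    1 / (i+1).  Its bounds 4 / (2i+3) and 4 / (2i+1) separate the far ends of
    the circles, so it contains no other one; its points on larger circles stay
    off the axis. *)
Definition cell i z : bool := i.*2.+1%:R * z.1 < 4 < i.*2.+3%:R * z.1.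

(** The signed number of times the axis is crossed near that far end. *)
Definition crossing i z w : int :=
  if cell i z && cell i w then ((w.2 < 0)%R : nat)%:Z - ((z.2 < 0)%R : nat)%:Z
  else 0.

Lemma crossing_refl i z : crossing i z z = 0.
Proof. by rewrite /crossing subrr if_same. Qed.

Lemma crossing_out i z w : ~~ (cell i z && cell i w) -> crossing i z w = 0.
Proof. by rewrite /crossing => /negbTE ->. Qed.

Lemma crossing_le1 i z w : `|crossing i z w| <= 1.
Proof.
by rewrite /crossing; case: ifP => // _; case: (w.2 < 0); case: (z.2 < 0).
Qed.

(** Disjoint strips: a short move cannot both change the sheet and wind around a
    smaller circle, so the two effects never interfere. *)
Lemma cell0_disjoint i z : cell 0 z -> ~~ cell i.+1 z.
Proof.
rewrite /cell /= => /andP[z0 z1]; rewrite negb_and -leNgt; apply/orP; left.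
have : (3%:R : R) <= i.+1.*2.+1%:R by rewrite ler_nat.
rewrite (_ : 0.*2.+3 = 3)%N // in z1 => c3; have z10 : 0 < z.1 by lra.
by have := ler_wpM2r (ltW z10) c3; lra.
Qed.

Definition crossing_additive i (O : set X) : Prop :=
  forall a b c : X, O a -> O b -> O c ->
    crossing i (\val a) (\val b) + crossing i (\val b) (\val c) =
    crossing i (\val a) (\val c).

Let fst_val_continuous : continuous (fun z : X => (\val z).1).
Proof.
apply: (@continuousT_comp _ _ _ (\val : X -> R * R) fst) => z.
  exact: set_val_continuous.
exact: cvg_fst.
Qed.

Let snd_val_continuous : continuous (fun z : X => (\val z).2).
Proof.
apply: (@continuousT_comp _ _ _ (\val : X -> R * R) snd) => z.
  exact: set_val_continuous.
exact: cvg_snd.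
Qed.

Let scale_val_continuous (c : R) : continuous (fun z : X => c * (\val z).1).
Proof.
apply: (continuousT_comp fst_val_continuous) => z.
by apply: cvgM; [exact: cvg_cst|exact: cvg_id].
Qed.

Lemma cell_near i (y : X) : cell i (\val y) ->
  \forall z \near y, cell i (\val z).
Proof.
case/andP=> y1 y2.
have h1 := scale_val_continuous (lt_nbhsl y1).
have h2 := scale_val_continuous (lt_nbhsr y2).
by near=> z; apply/andP; split; near: z.
Unshelve. all: by end_near. Qed.

(** On the axis the earring meets only the origin and the far ends
    (2 / j, 0); none of them lies on the boundary of a strip, by parity. *)
Lemma axis_cell_near i (y : X) : (\val y).2 = 0 -> ~~ cell i (\val y) ->
  \forall z \near y, ~~ cell i (\val z).
Proof.
move=> y0 yi.
have : (4 < i.*2.+1%:R * (\val y).1) \/ (i.*2.+3%:R * (\val y).1 < 4).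
  have := set_mem (valP y) => -[m _ [j /= /andP[j0 _]]].
  move=> /(circleE j0); rewrite y0 expr0n addr0 => yj.
  have [y1|y1] := eqVneq (\val y).1 0; first by right; rewrite y1 mulr0.
  have {}yj : j%:R * (\val y).1 = 2.
    by apply: (mulIf y1); rewrite -mulrA -expr2.
  have y1' : 0 < (\val y).1.
    have : 0 < j%:R * (\val y).1 by rewrite yj.
    by rewrite pmulr_rgt0 // ltr0n.
  have e4 : 4 = j.*2%:R * (\val y).1 by rewrite -muln2 natrM mulrAC yj; ring.
  move: yi; rewrite /cell e4 !ltr_pM2r // !ltr_nat.
  by rewrite negb_and -!leqNgt => /orP[h|h]; [left|right]; lia.
case=> h; [have hz := scale_val_continuous (lt_nbhsr h)|
           have hz := scale_val_continuous (lt_nbhsl h)].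
  near=> z; rewrite negb_and -!leNgt; apply/orP; left; apply: ltW; near: z.
  exact: hz.
near=> z; rewrite negb_and -!leNgt; apply/orP; right; apply: ltW; near: z.
exact: hz.
Unshelve. all: by end_near. Qed.

(** Off the axis the sign of the second coordinate is locally constant, and on
    the axis the membership in the strip is. *)
Lemma crossing_locally_additive i (y : X) :
  exists2 O, nbhs y O & crossing_additive i O.
Proof.
have same (b : bool) (O : set X) :
    (forall z : X, O z -> ((\val z).2 < 0) = b) -> crossing_additive i O.
  move=> Ob u v w /Ob ub /Ob vb /Ob wb.
  by rewrite /crossing ub vb wb !subrr !if_same.
have [y2|y2|y2] := ltgtP (\val y).2 0.
- exists [set z : X | (\val z).2 < 0]; last by apply: (same true).
  exact: snd_val_continuous (lt_nbhsl y2).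
- exists [set z : X | 0 < (\val z).2].
    exact: snd_val_continuous (lt_nbhsr y2).
  by apply: (same false) => z /= /ltW; rewrite leNgt => /negbTE.
have [yi|yi] := boolP (cell i (\val y)).
  exists [set z : X | cell i (\val z)]; first exact: cell_near.
  by move=> u v w /= ui vi wi; rewrite /crossing ui vi wi /=; ring.
exists [set z : X | ~~ cell i (\val z)]; first exact: axis_cell_near.
by move=> u v w /= /negbTE ui /negbTE vi /negbTE wi; rewrite /crossing ui vi wi.
Qed.

(** Change of sheet in the infinite cyclic cover that unrolls the first
    circle. *)
Definition wind (z w : X) (k : int) : int := k + crossing 0 (\val z) (\val w).

(** Winding around the (n+2)-nd circle is recorded on the sheet n alone, so that
    it takes n turns around the first circle to make it visible. *)
Definition wind_step n (z w : X) (s : int * int) : int * int :=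
  (wind z w s.1,
   s.2 + (if s.1 == n%:Z then crossing n.+1 (\val z) (\val w) else 0)).

Lemma wind_flat : locally_flat wind.
Proof.
move=> y; have [O Oy OA] := crossing_locally_additive 0 y; exists O => //.
by split=> [a s _|a b c s Oa Ob Oc];
  rewrite /wind ?crossing_refl ?addr0 // -addrA OA.
Qed.

Lemma wind_step_flat n : locally_flat (wind_step n).
Proof.
move=> y; have [O1 O1y O1A] := crossing_locally_additive 0 y.
have [O2 O2y O2A] := crossing_locally_additive n.+1 y.
exists (O1 `&` O2); first exact: filterI.
split=> [a [k l] _|a b c [k l] [Oa1 Oa2] [Ob1 Ob2] [Oc1 Oc2]].
  by rewrite /wind_step /wind /= !crossing_refl if_same !addr0.
rewrite /wind_step /wind /=; congr pair; first by rewrite -addrA O1A.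
rewrite -addrA; congr (_ + _).
have [/andP[a0 b0]|] := boolP (cell 0 (\val a) && cell 0 (\val b)).
  have /negbTE an := cell0_disjoint n a0.
  have /negbTE bn := cell0_disjoint n b0.
  by rewrite /crossing an bn !if_same.
move=> /crossing_out ->; rewrite addr0; case: ifP => // _; exact: O2A.
Qed.

Lemma transport_wind_step n (x : nat -> X) N s :
  (transport (wind_step n) x N s).1 = transport wind x N s.1.
Proof. by elim: N => //= N ->. Qed.

(** On each of the 2 ^ m flat blocks the sheet changes by at most one, however
    much the block is subdivided. *)
Lemma transport_wind_bound m d (f : I -> X) i :
  fine wind m f -> (i <= 2 ^ (m + d))%N ->
  `|transport wind (fun k => f (dyadic (m + d) k)) i 0| <= (2 ^ m).+1%:Z.
Proof.
move=> fm im; set x := fun k => _.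
have blk j r : (j < 2 ^ m)%N -> (r <= 2 ^ d)%N ->
    `|transport wind x (j * 2 ^ d + r) 0| <=
    `|transport wind x (j * 2 ^ d) 0| + 1.
  move=> jm rd; have [O fO Of] := fm j jm.
  rewrite (@transport_block _ _ wind x (2 ^ d) j r _ O) // => [|k kj].
    by rewrite {1}/wind (le_trans (ler_normD _ _)) // lerD2l crossing_le1.
  by apply: Of; exact: dyadic_in_block.
have nodes j : (j <= 2 ^ m)%N -> `|transport wind x (j * 2 ^ d) 0| <= j%:Z.
  elim: j => [|j IHj] jm; first by rewrite mul0n.
  rewrite mulSn addnC (le_trans (blk _ _ jm (leqnn _))) //.
  by rewrite intS addrC lerD2l IHj // ltnW.
have d0 : (0 < 2 ^ d)%N by rewrite expn_gt0.
move: im; rewrite leq_eqVlt => /orP[/eqP ->|im].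
  by rewrite expnD (le_trans (nodes _ _)) // lez_nat.
rewrite (divn_eq i (2 ^ d)); set j := (_ %/ _)%N.
have jm : (j < 2 ^ m)%N by rewrite ltn_divLR // -expnD.
rewrite (le_trans (blk _ _ jm _)) ?(ltnW (ltn_pmod _ _)) //.
by rewrite intS addrC lerD2l (le_trans (nodes _ (ltnW jm))) // lez_nat ltnW.
Qed.

(** The level m controls only the turns around the first circle, whereas the
    holonomy is computed on a subdivision that depends on n; what matters is
    that the bound 2 ^ m + 1 on the sheet does not depend on n. *)
Lemma holonomy_far m n (f : I -> X) : continuous f -> fine wind m f ->
  ((2 ^ m).+1 < n)%N -> (holonomy (wind_step n) f (0, 0)).2 = 0.
Proof.
move=> cf fm mn.
have [d _ /(_ d (leqnn d)) fd] := fine_near_infty (@wind_step_flat n) cf.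
have {}fd : fine (wind_step n) (m + d) f by rewrite addnC; exact: fine_refine.
rewrite (holonomyE _ fd) /dyadic_transport.
have : (2 ^ (m + d) <= 2 ^ (m + d))%N by [].
move: {-2}(2 ^ (m + d))%N => i; elim: i => //= i IHi im.
rewrite IHi 1?ltnW // add0r ifF //; apply/negbTE/eqP => e.
have := transport_wind_bound fm (ltnW im); rewrite transport_wind_step /= in e.
by rewrite e lez_nat leqNgt mn.
Qed.

End crossing.

(** * The loops around the circles *)

Section circle_loop.
Context {R : realType}.
Local Notation I := (unit_interval R).
Local Notation X := (set_type (@earring R)).
Local Notation origin := (@earring_origin R).

Definition circle_point i (t : R) : R * R :=
  (i.+1%:R^-1 * (1 - cos (pi *+ 2 * t)), i.+1%:R^-1 * sin (pi *+ 2 * t)).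

Lemma circle_point_circle i t : earring_circle i.+1 (circle_point i t).
Proof.
rewrite /earring_circle /circle_point /=.
have := cos2Dsin2 (pi *+ 2 * t).
move: (_^-1) (cos _) (sin _) => r c s cs.
by rewrite -[RHS]mulr1 -[in RHS]cs; ring.
Qed.

Lemma circle_point_earring i t : circle_point i t \in @earring R.
Proof.
apply/mem_set; exists i.+1 => //; exists i.+1; rewrite /= ?leqnn //.
exact: circle_point_circle.
Qed.

Definition circle_fun i (t : I) : X :=
  exist (fun z => z \in @earring R) (circle_point i (unit_val t))
    (circle_point_earring i (unit_val t)).

Lemma circle_continuous i : continuous (circle_fun i).
Proof.
have ct : continuous (fun t : I => pi *+ 2 * unit_val t).
  apply: (continuousT_comp unit_val_continuous) => t.
  by apply: cvgM; [exact: cvg_cst|exact: cvg_id].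
apply: continuous_set_type; apply: (@continuousT_pair _ _ _
    (fun t : I => i.+1%:R^-1 * (1 - cos (pi *+ 2 * unit_val t)))
    (fun t : I => i.+1%:R^-1 * sin (pi *+ 2 * unit_val t))).
  apply: (continuousT_comp (g := fun u => i.+1%:R^-1 * (1 - cos u)) ct) => t.
  apply: cvgM; first exact: cvg_cst.
  by apply: cvgB; [exact: cvg_cst|exact: continuous_cos].
apply: (continuousT_comp (g := fun u => i.+1%:R^-1 * sin u) ct) => t.
by apply: cvgM; [exact: cvg_cst|exact: continuous_sin].
Qed.

Lemma circle_point0 i : circle_point i 0 = (0, 0).
Proof. by rewrite /circle_point mulr0 cos0 sin0 subrr !mulr0. Qed.

Lemma circle_point1 i : circle_point i 1 = (0, 0).
Proof. by rewrite /circle_point mulr1 cos2pi sin2pi subrr !mulr0. Qed.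

Lemma circle_zero i : circle_fun i zero = origin.
Proof. by apply: val_inj; rewrite /= unit_val0 circle_point0. Qed.

Lemma circle_one i : circle_fun i one = origin.
Proof. by apply: val_inj; rewrite /= unit_val1 circle_point1. Qed.

Definition circle_loop i : loop_space R origin :=
  mk_path (@circle_continuous i) (circle_zero i) (circle_one i).

Lemma circle_upper i t : 0 <= t <= 2^-1 -> (circle_point i t).2 < 0 = false.
Proof.
move=> t01; apply/negbTE; rewrite -leNgt /= mulr_ge0 ?invr_ge0 //.
by apply: sin_ge0_pi; have := pi_gt0 R; move: (pi) => p p0; nra.
Qed.

Lemma circle_lower i t : 2^-1 < t < 1 -> (circle_point i t).2 < 0.
Proof.
move=> t01; rewrite /= pmulr_rlt0 ?invr_gt0 //.
have -> : pi *+ 2 * t = (pi *+ 2 * t - pi) + pi by rewrite subrK.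
rewrite sinDpi oppr_lt0; apply: sin_gt0_pi.
by have := pi_gt0 R; move: (pi) => p p0; nra.
Qed.

Lemma cell_circle_half i j : cell j (circle_point i 2^-1) = (i == j).
Proof.
have -> : circle_point i 2^-1 = (2 / i.+1%:R, 0 : R).
  rewrite /circle_point (_ : pi *+ 2 * 2^-1 = pi); last first.
    by rewrite -[pi *+ 2]mulr_natr mulfK ?pnatr_eq0.
  by rewrite cospi sinpi mulr0 opprK mulrC.
rewrite /cell /= !mulrA ltr_pdivrMr ?ltr_pdivlMr ?ltr0n //.
rewrite -!natrM !ltr_nat; apply/idP/eqP; lia.
Qed.

Lemma cell_origin j : cell j (0, 0 : R) = false.
Proof. by rewrite /cell /= !mulr0 ltr0n ltNge ler0n. Qed.

(** Once the subdivision is fine, the loop around a circle crosses the axis once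
    in a strip, just after the middle of the parameter interval, and only in
    the strip of its own far end; at its end it returns to the origin, which
    lies in no strip. *)
Lemma crossing_circle i j : \forall m \near \oo, forall k,
  (k < 2 ^ m.+1)%N ->
  crossing j (\val (circle_loop i (dyadic m.+1 k)))
             (\val (circle_loop i (dyadic m.+1 k.+1))) =
  ((i == j) && (k == 2 ^ m)%N : nat)%:Z.
Proof.
have half01 : 0 <= (2^-1 : R) <= 1 by rewrite invr_ge0 ler0n /= invf_le1 ?ler1n.
pose half : I := unit_proj 2^-1.
have cell_half : \forall u \near (2^-1 : R),
    cell i (\val (circle_loop i (unit_proj u))).
  have cl : continuous (circle_loop i \o unit_proj).
    exact: (continuousT_comp (@unit_proj_continuous R) (@circle_continuous i)).
  have := @cell_near R i (circle_loop i half).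
  rewrite /= unit_projE // cell_circle_half eqxx => /(_ isT) h.
  exact: cl h.
have cell_next : \forall m \near \oo,
    cell i (\val (circle_loop i (dyadic m.+1 (2 ^ m).+1))).
  have [e /= e0 eP] := (nbhs_ballP _ _).1 cell_half.
  have [M _ MP] := near_infty_natSinv_expn_lt (PosNum e0).
  exists M => // m /= Mm; apply: eP.
  rewrite /ball /= -(natr1 (2 ^ m)) natrX exprS mulrDl invfM mulrCA.
  rewrite divff ?expf_neq0 //.
  rewrite mulr1 mul1r opprD addNKr normrN gtr0_norm; last first.
    by rewrite mulr_gt0 ?invr_gt0 ?exprn_gt0.
  apply: le_lt_trans (MP m Mm); rewrite ler_wpM2r ?invr_ge0 ?exprn_ge0 //.
  by have /andP[] := half01.
near=> m => k km.
have mM : (2 ^ m.+1 = 2 ^ m + 2 ^ m)%N by rewrite expnS mul2n addnn.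
have m1 : (1 < 2 ^ m)%N.
  have : (0 < m)%N by near: m; exact: nbhs_infty_gt.
  by case: (m) => // m' _; rewrite expnS; have := expn_gt0 2 m'; lia.
have halfE : 2^-1 = (2 ^ m)%N%:R / 2 ^+ m.+1 :> R.
  by rewrite natrX exprS invfM mulrCA divff ?mulr1 ?expf_neq0.
have up l : (l <= 2 ^ m)%N ->
    ((circle_point i (unit_val (@dyadic R m.+1 l))).2 < 0) = false.
  move=> lm; apply: circle_upper.
  have /andP[-> _] /= := unit_val_bound (@dyadic R m.+1 l).
  rewrite dyadicE ?mM ?halfE ?ler_pM2r ?invr_gt0 ?exprn_gt0 ?ler_nat //.
  by rewrite (leq_trans lm) ?leq_addr.
have low l : (2 ^ m < l < 2 ^ m.+1)%N ->
    (circle_point i (unit_val (@dyadic R m.+1 l))).2 < 0.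
  move=> /andP[lm ml]; apply: circle_lower; rewrite dyadicE ?(ltnW ml) //.
  rewrite halfE ltr_pM2r ?invr_gt0 ?exprn_gt0 // ltr_nat lm /=.
  by rewrite ltr_pdivrMr ?exprn_gt0 // mul1r -natrX ltr_nat.
have [kh|kh|kh] := ltngtP k (2 ^ m)%N; rewrite ?andbF /=.
- by rewrite /crossing /= !up ?subrr ?if_same // ltnW.
- have [k1|k1] : (k.+1 = 2 ^ m.+1 \/ k.+1 < 2 ^ m.+1)%N by lia.
    by rewrite k1 dyadic1 unit_val1 circle_point1 /crossing cell_origin andbF.
  by rewrite /crossing /= !low ?subrr ?if_same ?kh // (leqW kh).
have xh : cell j (circle_point i (unit_val (@dyadic R m.+1 k))) = (i == j).
  by rewrite kh dyadicE ?mM ?leq_addr // -halfE cell_circle_half.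
rewrite andbT /crossing /= xh; have [ij|] := eqVneq i j => //=.
rewrite -ij {1}kh (_ : cell i _ = true); last by near: m; exact: cell_next.
by rewrite (up k) ?(low k.+1) ?kh //; lia.
Unshelve. all: by end_near. Qed.

Lemma holonomy_circle n i s : holonomy (wind_step n) (circle_loop i) s =
  (s.1 + (i == 0%N : nat)%:Z,
   s.2 + ((i == n.+1) && (s.1 == n%:Z) : nat)%:Z).
Proof.
have [M1 _ fM] := fine_near_infty (@wind_step_flat R n) (@circle_continuous i).
have [M2 _ c0M] := crossing_circle i 0.
have [M3 _ cnM] := crossing_circle i n.+1.
pose m := (M1 + M2 + M3)%N.
have /c0M c0 : (M2 <= m)%N by rewrite /m; lia.
have /cnM cn : (M3 <= m)%N by rewrite /m; lia.
have fm : fine (wind_step n) m.+1 (circle_loop i).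
  by apply: fM; rewrite /m /=; lia.
rewrite (holonomyE _ fm) /dyadic_transport.
set x := fun k => _; set s' := (_, _).
have xE k : (k <= 2 ^ m.+1)%N -> transport (wind_step n) x k s =
    if (k <= 2 ^ m)%N then s else s'.
  elim: k => [//|k IHk] km /=; rewrite IHk ?(ltnW km) // /wind_step /wind.
  rewrite c0 // cn //.
  have [kh|kh|kh] := ltngtP k (2 ^ m)%N;
    rewrite ?andbF ?andbT /= ?if_same ?addr0.
  - by rewrite -surjective_pairing.
  - by [].
  - rewrite /s'; congr pair; congr (_ + _).
    by case: eqP; rewrite ?andbT ?andbF.
by rewrite xE // leqNgt ltn_exp2l // ltnSn.
Qed.

End circle_loop.

(** * The spikes and the failure of continuity *)

Lemma cvg_initial {S : choiceType} {T : topologicalType} (f : S -> T)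
    (F : set_system S) (x : S) :
  Filter F -> f @ F --> f x -> F --> (x : initial_topology f).
Proof.
move=> FF cvf A [_ [[B oB <-] Bx] BA]; apply: filterS BA _.
by apply: cvf; exact: open_nbhs_nbhs.
Qed.

Section spikes.
Context {R : realType}.
Local Notation origin := (@earring_origin R).
Local Notation G := (pi1 R origin).
Implicit Types (a b : G) (n k : nat) (s : int * int).

Definition pi1_holonomy n a s : int * int := holonomy (wind_step n) (repr a) s.

Lemma pi1_holonomyE n (f : loop_space R origin) s :
  pi1_holonomy n (loop_class f) s = holonomy (wind_step n) f s.
Proof.
by apply: holonomy_homotopic; [exact: wind_step_flat|exact: repr_loop_class].
Qed.

Lemma pi1_holonomyM n a b s :
  pi1_holonomy n (a * b)%g s = pi1_holonomy n b (pi1_holonomy n a s).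
Proof.
rewrite [(a * b)%g]/(loop_class (loop_cat (repr a) (repr b))) pi1_holonomyE.
exact: (holonomy_cat (@wind_step_flat R n)).
Qed.

Lemma pi1_holonomy1 n s : pi1_holonomy n 1%g s = s.
Proof.
by rewrite pi1_holonomyE; exact: (holonomy_const (@wind_step_flat R n)).
Qed.

Definition no_diagonal_winding : set G :=
  [set a | forall n, (pi1_holonomy n a (0, 0)).2 = 0].

Lemma no_diagonal_winding1 : no_diagonal_winding 1%g.
Proof. by move=> n; rewrite pi1_holonomy1. Qed.

(** Near a loop f, [holonomy_far] disposes of all n above a bound given by f,
    and [holonomy_near] of the finitely many others. *)
Lemma no_diagonal_winding_open : open no_diagonal_winding.
Proof.
apply/open_pi1; rewrite openE => f fU; rewrite /interior.
have {}fU n : (holonomy (wind_step n) f (0, 0)).2 = 0.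
  by rewrite -pi1_holonomyE; exact: fU.
have [m fm] := fine_near (@wind_flat R) f.
have fn : \forall g \near f, forall n : 'I_(2 ^ m).+2,
    holonomy (wind_step n) (g : loop_space R origin) (0, 0) =
    holonomy (wind_step n) f (0, 0).
  apply: (@filter_forall _ _ _ _ (nbhs_filter (f : loop_space R origin))) => n.
  apply: filterS (holonomy_near (@wind_step_flat R n) f) => g; exact.
apply: filterS2 fm fn => g gm gn n; rewrite pi1_holonomyE.
have [nm|nm] := ltnP n (2 ^ m).+2; first by rewrite (gn (Ordinal nm)) fU.
by apply: holonomy_far gm _; first exact: cts_fun.
Qed.

(** The class y_n: n turns around the first circle are needed to reach the sheet
    on which the loop around the (n+2)-nd circle is counted. *)
Definition spike n : G :=
  let a := (loop_class (circle_loop 0) : G) in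
  (a ^+ n * loop_class (circle_loop n.+1) * (a ^+ n)^-1)%g.

Lemma spike_large n : ~ no_diagonal_winding (spike n).
Proof.
move=> /(_ n).
have pow k (l : int) :
    pi1_holonomy n ((loop_class (circle_loop 0) : G) ^+ k)%g (0, l) = (k%:Z, l).
  elim: k => [|k IHk]; first by rewrite expg0 pi1_holonomy1.
  rewrite expgSr pi1_holonomyM IHk pi1_holonomyE holonomy_circle /= addr0.
  by rewrite -PoszD addn1.
rewrite /spike !pi1_holonomyM pow pi1_holonomyE holonomy_circle /=.
rewrite !eqxx addr0 /=.
by rewrite add0r -(pow n 1) -pi1_holonomyM mulgV pi1_holonomy1.
Qed.

Lemma spike_collapse n k : (k <= n)%N ->
  pi1_sequence (spike n) k = pi1_sequence 1%g k.
Proof.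
move=> kn; rewrite /pi1_sequence /spike.
set f := pi1_map _.
have fM : {morph f : a b / (a * b)%g} by exact: pi1_mapM.
have f1 : f 1%g = 1%g.
  by apply: (mulgI (f 1%g)); rewrite -fM !mulg1.
rewrite !fM (_ : f (loop_class _) = 1%g); first by rewrite mulg1 -fM mulgV.
rewrite /f pi1_mapE; congr loop_class; apply/path_eqP => t.
apply: (@collapse_circle R (@earring R) k n.+2) => //.
exact: circle_point_circle.
Qed.

Lemma spike_cvg :
  @canonical_injection R (spike n) @[n --> \oo] --> canonical_injection 1%g.
Proof.
apply: cvg_initial; apply/cvg_sup => k; apply: cvg_initial.
apply: cvg_near_cst; exists k => // n /= kn.
exact: spike_collapse.
Qed.

End spikes.

Theorem theorem2p1 (R : realType) :
  ~ topological_embedding (@canonical_injection R).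
Proof.
move=> [_ [g [gK _ cg]]].
pose phi := corestriction (@canonical_injection R).
have phi_cvg : phi (spike n) @[n --> \oo] --> phi 1%g.
  by apply: cvg_initial; exact: spike_cvg.
have : (g \o phi) (spike n) @[n --> \oo] --> (g \o phi) 1%g.
  apply: (@cvg_comp _ _ _ (fun n => phi (spike n)) g _ _ _ phi_cvg).
  exact: cg.
move=> /(_ no_diagonal_winding)[].
  apply: open_nbhs_nbhs; split; first exact: no_diagonal_winding_open.
  by rewrite /= gK; exact: no_diagonal_winding1.
by move=> N _ /(_ N (leqnn N)); rewrite /= gK; exact: spike_large.
Qed.
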